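(* Let $\epsilon,\mu>0$ be constants. Assume that $F_0:\mathbb{R}^3\to\mathbb{C}^3$ is periodic and can be expressed by its Fourier series $$F_0(\mathbf{x})=f_0+\sum_{\mathbf{w}\neq0}\mathbf{a}_{\mathbf{w}}e^{i\mathbf{x}\cdot\mathbf{w}}=f_0+\sum_{\mathbf{w}\neq0}\sum_{1\le d\le3}\alpha_{d,\mathbf{w}}\mathbf{v}_{d,\mathbf{w}}e^{i\mathbf{x}\cdot\mathbf{w}},$$ where $f_0\in\mathbb{C}^3$ is constant, $\mathbf{a}_{\mathbf{w}}\in\mathbb{C}^3$, and $(\alpha_{1,\mathbf{w}},\alpha_{2,\mathbf{w}},\alpha_{3,\mathbf{w}})^T=V_{\mathbf{w}}^\dagger\mathbf{a}_{\mathbf{w}}$. Further assume that $$\sum_{\mathbf{w}\neq0}|\mathbf{w}|\,|\mathbf{a}_{\mathbf{w}}|<\infty.$$ Then the Cauchy problem $$\frac{\partial\mathbf{F}}{\partial t}=-\frac{i}{\sqrt{\mu\epsilon}}\,\mathrm{curl}\,\mathbf{F},\qquad \mathbf{F}(\mathbf{x},0)=F_0(\mathbf{x})$$ is solved by $$\mathbf{F}(\mathbf{x},t)=f_0+\sum_{\mathbf{w}\neq0}\sum_{1\le d\le3}e^{\frac{-it\mu_{d,\mathbf{w}}}{\sqrt{\mu\epsilon}}}\,\alpha_{d,\mathbf{w}}\mathbf{v}_{d,\mathbf{w}}e^{i\mathbf{x}\cdot\mathbf{w}}.$$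
   Context: The sums run over the nonzero wave vectors $\mathbf{w}\in\mathbb{R}^3$ occurring in the Fourier series of the periodic function $F_0$ (nonzero elements of the lattice dual to its period lattice). With $\mathbf{F}=\sqrt\epsilon\,\mathbf{E}+i\sqrt\mu\,\mathbf{H}$ ($\mathbf{E},\mathbf{H}$ real), the Cauchy problem is equivalent to Maxwell's equations $\partial_t\mathbf{H}=-\frac1\mu\mathrm{curl}\,\mathbf{E}$, $\partial_t\mathbf{E}=\frac1\epsilon\mathrm{curl}\,\mathbf{H}$. The curl acts in $\mathbf{x}$ and is extended complex-linearly. For $\mathbf{w}=(w_1,w_2,w_3)^T\in\mathbb{R}^3\setminus\{0\}$ put $s_{\mathbf{w}}=w_1+w_2+w_3$, $\mathbf{r}_{\mathbf{w}}=(w_2-w_3,w_3-w_1,w_1-w_2)^T$, $\nu_{\mathbf{w}}=\sqrt2\,|\mathbf{r}_{\mathbf{w}}|/|\mathbf{w}|$, and $\mu_{1,\mathbf{w}}=0$, $\mu_{2,\mathbf{w}}=-|\mathbf{w}|$, $\mu_{3,\mathbf{w}}=|\mathbf{w}|$ (not to be confused with the constant $\mu$). Put $\mathbf{v}_{1,\mathbf{w}}=\mathbf{w}/|\mathbf{w}|$. If $\mathbf{r}_{\mathbf{w}}\neq0$, put for $d=2,3$ $$\mathbf{v}_{d,\mathbf{w}}=\frac{1}{\nu_{\mathbf{w}}}\left(\frac{s_{\mathbf{w}}}{|\mathbf{w}|^2}\mathbf{w}-(1,1,1)^T-i\frac{\mu_{d,\mathbf{w}}}{|\mathbf{w}|^2}\mathbf{r}_{\mathbf{w}}\right).$$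 If $\mathbf{r}_{\mathbf{w}}=0$, i.e. $w_1=w_2=w_3=\omega$, let $v_2=\frac{1}{\sqrt3}\left(\frac{1+i\sqrt3}{2},\frac{1-i\sqrt3}{2},-1\right)^T$ and put $\mathbf{v}_{2,\mathbf{w}}=v_2$ if $\omega\ge0$, $\mathbf{v}_{2,\mathbf{w}}=\overline{v_2}$ if $\omega<0$, and $\mathbf{v}_{3,\mathbf{w}}=\overline{\mathbf{v}_{2,\mathbf{w}}}$. $V_{\mathbf{w}}$ is the matrix with columns $\mathbf{v}_{1,\mathbf{w}},\mathbf{v}_{2,\mathbf{w}},\mathbf{v}_{3,\mathbf{w}}$ and $V_{\mathbf{w}}^\dagger$ its conjugate transpose. *)

(* Defs.v *)
From HB Require Import structures.
From mathcomp Require Import all_boot all_order all_algebra finmap.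
From mathcomp Require Import all_classical all_reals all_analysis.
From mathcomp Require Import complex.
From mathcomp.analysis.showcase Require Import summability.
Set Implicit Arguments.
Unset Strict Implicit.
Unset Printing Implicit Defensive.
Import Order.TTheory GRing.Theory Num.Theory.
Import numFieldNormedType.Exports.
Local Open Scope classical_set_scope.
Local Open Scope ring_scope.
Local Open Scope complex_scope.

(* The complex numbers R[i] are regarded, through the alias [Rcomplex R], as a
   normed space over R; limits and derivatives of complex-valued functions of
   real variables are taken in this space. *)
Lemma normr_RcomplexZ (R : realType) (k : R) (z : Rcomplex R) :
  `|k *: z| = `|k| * `|z|.
Proof.
by case: z => a b; rewrite /Num.norm /= !exprMn -mulrDr sqrtrM ?sqr_ge0// sqrtr_sqr.
Qed.

Section RcomplexNormed.
Variable R : realType.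
HB.instance Definition _ :=
  PseudoMetric.copy (Rcomplex R) (pseudoMetric_normed (Rcomplex R)).
HB.instance Definition _ := isPointed.Build (Rcomplex R) 0.
HB.instance Definition _ :=
  NormedZmod_PseudoMetric_eq.Build R (Rcomplex R) erefl.
HB.instance Definition _ :=
  PseudoMetricNormedZmod_Lmodule_isNormedModule.Build R (Rcomplex R)
    (@normr_RcomplexZ R).
End RcomplexNormed.

Section Vectors.
Variable R : realType.
Implicit Types (w x : 'cV[R]_3).

Definition vec3 (T : Type) (a b c : T) : 'cV[T]_3 :=
  \col_i tnth [tuple a; b; c] i.

Definition dot x w : R := \sum_i x i 0 * w i 0.

(* Euclidean norms; the library norm on matrices is the maximum norm *)
Definition enorm w : R := Num.sqrt (\sum_i w i 0 ^+ 2).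
Definition cnorm (z : 'cV[R[i]]_3) : R :=
  Num.sqrt (\sum_i `|z i 0 : Rcomplex R| ^+ 2).

Definition toC w : 'cV[R[i]]_3 := map_mx (fun a => a%:C) w.

Definition expi (theta : R) : R[i] := cos theta +i* sin theta.

End Vectors.

Section Lattices.
Variable R : realType.
Implicit Types (L : set 'cV[R]_3).

(* the lattice spanned over the integers by the columns of P *)
Definition lattice (P : 'M[R]_3) : set 'cV[R]_3 :=
  [set P *m map_mx intr m | m in [set: 'cV[int]_3]].

Definition dual_lattice L : set 'cV[R]_3 :=
  [set w | forall p, L p -> exists k : int, dot p w = 2 * pi * k%:~R].

Definition wave_vectors L : set 'cV[R]_3 := dual_lattice L `\ 0.

Definition periodic_wrt L (F : 'cV[R]_3 -> 'cV[R[i]]_3) :=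
  forall p x, L p -> F (x + p) = F x.

End Lattices.

Section UnorderedSums.
Variables (R : realType) (T : choiceType) (D : set T).
Implicit Types (f : T -> 'cV[R[i]]_3).

(* Componentwise unordered sum over D: the limit of the sums of f over the
   finite subsets of D, directed by inclusion *)
Definition coord_on f (i : 'I_3) : T -> Rcomplex R :=
  patch (fun=> 0) D (fun w => f w i 0).

Definition vsum f : 'cV[R[i]]_3 := \col_i sum (coord_on f i).

Definition vsum_cvg f :=
  forall i, cvg (partial_sum (coord_on f i) @ totally).

End UnorderedSums.

Section Eigenvectors.
Variable R : realType.
Implicit Types (w : 'cV[R]_3) (d : 'I_3).

Definition s_ w : R := \sum_i w i 0.

Definition r_ w : 'cV[R]_3 :=
  let w1 := w 0 0 in let w2 := w 1 0 in let w3 := w 2 0 in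
  vec3 (w2 - w3) (w3 - w1) (w1 - w2).

Definition nu_ w : R := Num.sqrt 2 * enorm (r_ w) / enorm w.

(* The indices d = 1, 2, 3 of the eigenvalues and eigenvectors are the
   elements 0, 1, 2 of 'I_3. *)
Definition mu_ d w : R := tnth [tuple 0; - enorm w; enorm w] d.

Definition v2_diag : 'cV[R[i]]_3 :=
  (Num.sqrt 3)^-1%:C *: vec3 ((1 + 'i * (Num.sqrt 3)%:C) / 2)
                             ((1 - 'i * (Num.sqrt 3)%:C) / 2) (-1).

Definition v_ d w : 'cV[R[i]]_3 :=
  if d == 0 then (enorm w)^-1%:C *: toC w
  else if r_ w != 0 then
    (nu_ w)^-1%:C *:
      ((s_ w / enorm w ^+ 2)%:C *: toC w - const_mx 1
       - ('i * (mu_ d w / enorm w ^+ 2)%:C) *: toC (r_ w))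
  else
    let v2 := if 0 <= w 0 0 then v2_diag else map_mx conjc v2_diag in
    if d == 1 then v2 else map_mx conjc v2.

Definition V_ w : 'M[R[i]]_3 := \matrix_(i, d) v_ d w i 0.

Definition adjmx (A : 'M[R[i]]_3) : 'M[R[i]]_3 := map_mx conjc A^T.

Definition alpha_ (a : 'cV[R]_3 -> 'cV[R[i]]_3) d w : R[i] :=
  (adjmx (V_ w) *m a w) d 0.

End Eigenvectors.

Section CauchyProblem.
Variable R : realType.
Implicit Types (F : 'cV[R]_3 -> R -> 'cV[R[i]]_3).

Definition basis3 (j : 'I_3) : 'cV[R]_3 := delta_mx j 0.

Definition dC (U : normedModType R) (f : U -> Rcomplex R) (x v : U) : R[i] :=
  'D_v f x.

Definition curl (G : 'cV[R]_3 -> 'cV[R[i]]_3) x : 'cV[R[i]]_3 :=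
  let D j k := dC (fun y => G y k 0) x (basis3 j) in
  vec3 (D 1 2 - D 2 1) (D 2 0 - D 0 2) (D 0 1 - D 1 0).

Definition dt F x t : 'cV[R[i]]_3 := \col_k dC (fun s => F x s k 0) t 1.

Definition partially_derivable F :=
  forall x t k,
    derivable ((fun s => F x s k 0) : R -> Rcomplex R) t 1 /\
    forall j, derivable ((fun y => F y t k 0) : 'cV[R]_3 -> Rcomplex R) x
                (basis3 j).

Definition solves_cauchy (eps mu : R) (F0 : 'cV[R]_3 -> 'cV[R[i]]_3) F :=
  [/\ partially_derivable F,
      forall x t, dt F x t =
        - ('i / (Num.sqrt (mu * eps))%:C) *: curl (fun y => F y t) x
    & forall x, F x 0 = F0 x].

End CauchyProblem.

(* Main.v *)
(* Each v_d,w is an eigenvector of the symbol i w x . of the curl, with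
   eigenvalue mu_d,w, so every term of the series solves the equation; at t = 0
   the terms add up to a_w e^(i x.w) because V_w is unitary. The wave vectors
   are bounded away from 0, hence both sum |a_w| and sum |w| |a_w| are finite;
   as |e^(i h theta) - 1| <= 2 |h theta|, the difference quotients of the terms
   are dominated by a multiple of |w| |a_w|, and Tannery's theorem for unordered
   sums allows differentiation term by term. *)
Require Import Defs.
From mathcomp Require Import all_boot all_order all_algebra finmap.
From mathcomp Require Import all_classical all_reals all_analysis.
From mathcomp Require Import complex.
From mathcomp.analysis.showcase Require Import summability.
From mathcomp Require Import ring lra.
Import Order.TTheory GRing.Theory Num.Theory.
Import numFieldNormedType.Exports.
Local Open Scope classical_set_scope.
Local Open Scope ring_scope.
Local Open Scope complex_scope.
Set Implicit Arguments.
Unset Strict Implicit.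
Unset Printing Implicit Defensive.

#[local] Existing Instance totally_filter.

(** * Unordered sums under a summable majorant, and Tannery's theorem *)

Lemma partial_sumE (T : choiceType) (V : zmodType) (x : T -> V) (J : {fset T}) :
  partial_sum x J = \sum_(i <- J) x i.
Proof. by rewrite /partial_sum big_seq_fsetE. Qed.

Lemma near_totally (T : choiceType) (J : {fset T}) :
  \forall I \near totally, (J `<=` I)%fset.
Proof. by exists J. Qed.

(** For nonnegative [K] this is summability, put in terms of finite sums so that no limit has to be
    handled. *)
Definition bounded_sums (R : realType) (T : choiceType) (K : T -> R) :=
  exists M, forall J : {fset T}, \sum_(i <- J) K i <= M.

Section DominatedSums.
Variables (R : realType) (T : choiceType) (K : T -> R).
Hypothesis (Kbnd : bounded_sums K).

(** Once the sum over [J] is within [e] of the supremum of all finite sums, less than [e] is left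
    for any finite set of further indices. *)
Lemma bounded_sums_tail (e : R) : 0 < e ->
  exists J : {fset T}, forall I : {fset T}, (J `<=` I)%fset ->
    \sum_(i <- [fset i in I | i \notin J]%fset) K i <= e.
Proof.
move=> e0; case: Kbnd => M KM.
pose S := [set \sum_(i <- J) K i | J in [set: {fset T}]].
have supS : has_sup S.
  split; first by exists (\sum_(i <- fset0) K i), fset0.
  by exists M => _ [J _ <-].
have [_ [J _ <-] ltJ] := sup_adherent e0 supS.
exists J => I JI.
have leI : \sum_(i <- I) K i <= sup S.
  by apply: ub_le_sup; [case: supS | exists I].
move: leI; rewrite (big_fsetID _ (mem J)) /= => leI.
have JE : \sum_(i <- [fset x in I | x \in J]%fset) K i = \sum_(i <- J) K i.
  apply: eq_fbigl => i; rewrite !inE /=.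
  by case: (boolP (i \in J)) => [/(fsubsetP JI) -> //|]; rewrite andbF.
move: leI; rewrite JE => leI; lra.
Qed.

Section Normed.
Variables (V : normedModType R) (x : T -> V).
Hypothesis xK : forall i, `|x i| <= K i.

Lemma dominated_partial_sum_tail (e : R) (J I : {fset T}) :
  \sum_(i <- [fset i in I | i \notin J]%fset) K i <= e -> (J `<=` I)%fset ->
  `|partial_sum x I - partial_sum x J| <= e.
Proof.
move=> tl JI; rewrite !partial_sumE (big_fsetID _ (mem J) I) /=.
have -> : \sum_(i <- [fset x in I | x \in J]%fset) x i = \sum_(i <- J) x i.
  apply: eq_fbigl => i; rewrite !inE /=.
  by case: (boolP (i \in J)) => [/(fsubsetP JI) -> //|]; rewrite andbF.
rewrite addrC addrK.
apply: le_trans tl; apply: le_trans (ler_norm_sum _ _ _) _.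
by apply: ler_sum => i _; exact: xK.
Qed.

Lemma dominated_cauchy_ex : cauchy_ex (partial_sum x @ totally).
Proof.
(* Half of [e], since the tail estimate is not strict while the ball is open. *)
move=> e e0; have [J tJ] := bounded_sums_tail (divr_gt0 e0 (ltr0n R 2)).
exists (partial_sum x J); exists J => //= I JI.
rewrite -ball_normE /= distrC.
apply: le_lt_trans (dominated_partial_sum_tail (tJ _ JI) JI) _.
by rewrite ltr_pdivrMr// mulr_natr mulr2n ltrDl.
Qed.

(** The limit over [I] of the estimate between partial sums. *)
Lemma dominated_sum_tail (e : R) (J : {fset T}) :
  cvg (partial_sum x @ totally) ->
  (forall I : {fset T}, (J `<=` I)%fset ->
    \sum_(i <- [fset i in I | i \notin J]%fset) K i <= e) ->
  `|sum x - partial_sum x J| <= e.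
Proof.
move=> cx tJ.
have cn : `|partial_sum x I - partial_sum x J| @[I --> totally] -->
    `|sum x - partial_sum x J|.
  by apply: cvg_norm; apply: cvgB; [exact: cx | exact: cvg_cst].
rewrite -(cvg_lim (@Rhausdorff R) cn); apply: limr_le; first exact: cvgP cn.
near=> I; apply: dominated_partial_sum_tail;
  last by near: I; exact: near_totally.
by apply: tJ; near: I; exact: near_totally.
Unshelve. all: by end_near.
Qed.

End Normed.

(** The majorant yields one finite [J] outside of which every [E s] contributes at most [e / 2];
    over [J] a finite sum of null functions tends to 0. *)
Lemma tannery (V : normedModType R) (S : Type) (F : set_system S)
    (FF : Filter F) (E : S -> T -> V) :
  (forall s i, `|E s i| <= K i) ->
  (forall s, cvg (partial_sum (E s) @ totally)) ->
  (forall i, E^~ i @ F --> 0) -> (fun s => sum (E s)) @ F --> 0.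
Proof.
move=> EK cE E0; apply/cvgr0Pnorm_le => e e0.
have [J tJ] := bounded_sums_tail (divr_gt0 e0 (ltr0n R 2)).
have pE0 : (fun s => partial_sum (E s) J) @ F --> 0.
  have : \sum_(i <- J) E s i @[s --> F] --> \sum_(i <- J) (0 : V).
    by apply: cvg_big => //; exact: add_continuous.
  by rewrite big1//; under eq_cvg do rewrite -partial_sumE.
move/cvgr0Pnorm_le : pE0 => /(_ _ (divr_gt0 e0 (ltr0n R 2))).
apply: filterS => s sJ.
rewrite -(subrK (partial_sum (E s) J) (sum (E s))).
rewrite (splitr e); apply: le_trans (ler_normD _ _) _; apply: lerD => //.
exact: (dominated_sum_tail (EK s)).
Qed.

End DominatedSums.

(** * Linearity of unordered sums *)

Section SumLinearity.
Variables (R : realType) (T : choiceType).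

Lemma cvg_sumE (V : normedModType R) (x : T -> V) (l : V) :
  partial_sum x @ totally --> l -> sum x = l.
Proof. by move=> xl; apply: cvg_lim xl; exact: norm_hausdorff. Qed.

Lemma cvg_partial_sumB (V : normedModType R) (x y : T -> V) :
  cvg (partial_sum x @ totally) -> cvg (partial_sum y @ totally) ->
  partial_sum (fun i => x i - y i) @ totally --> sum x - sum y.
Proof.
move=> cx cy.
have -> : partial_sum (fun i => x i - y i) =
    fun J => partial_sum x J - partial_sum y J.
  by apply/funext => J; rewrite !partial_sumE sumrB.
exact: cvgB.
Qed.

Lemma cvg_partial_sumZ (V : normedModType R) (k : R) (x : T -> V) :
  cvg (partial_sum x @ totally) ->
  partial_sum (fun i => k *: x i) @ totally --> k *: sum x.
Proof.
move=> cx.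
have -> : partial_sum (fun i => k *: x i) = fun J => k *: partial_sum x J.
  by apply/funext => J; rewrite !partial_sumE scaler_sumr.
by apply: cvgZ => //; exact: cvg_cst.
Qed.

Lemma bounded_sumsZ (k : R) (K : T -> R) : 0 <= k -> bounded_sums K ->
  bounded_sums (fun i => k * K i).
Proof.
move=> k0 [M KM]; exists (k * M) => J.
by rewrite -mulr_sumr ler_wpM2l.
Qed.

End SumLinearity.

(** * The complex numbers as a real normed space, and dominated sums in it *)

Section RcomplexNorm.
Variable R : realType.
Implicit Types z : Rcomplex R.

Lemma normRcE z : `|z| = Num.sqrt (complex.Re z ^+ 2 + complex.Im z ^+ 2).
Proof. by case: z. Qed.

Lemma normRcM (x y : R[i]) :
  `|x * y : Rcomplex R| = `|x : Rcomplex R| * `|y : Rcomplex R|.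
Proof. exact: Normc.normcM. Qed.

Lemma normRc_real (x : R) : `|x%:C : Rcomplex R| = `|x|.
Proof. by rewrite normRcE/= expr0n/= addr0 sqrtr_sqr. Qed.

Lemma normRc_conj (x : R[i]) : `|conjc x : Rcomplex R| = `|x : Rcomplex R|.
Proof. by case: x => a b; rewrite normRcE/= sqrrN. Qed.

Lemma normRc_i : `|'i : Rcomplex R| = 1.
Proof. by rewrite normRcE/= expr0n expr1n/= add0r sqrtr1. Qed.

Lemma normRc_ge_Re z : `|complex.Re z| <= `|z|.
Proof.
case: z => a b; rewrite normRcE/= -sqrtr_sqr.
by apply: ler_wsqrtr; rewrite lerDl sqr_ge0.
Qed.

Lemma normRc_ge_Im z : `|complex.Im z| <= `|z|.
Proof.
case: z => a b; rewrite normRcE/= -sqrtr_sqr.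
by apply: ler_wsqrtr; rewrite lerDr sqr_ge0.
Qed.

Lemma normRc_le z : `|z| <= `|complex.Re z| + `|complex.Im z|.
Proof.
case: z => a b /=; have -> : (a +i* b) = a%:C + 'i * b%:C :> R[i] by simpc.
apply: le_trans (ler_normD (a%:C : Rcomplex R) _) _.
by rewrite normRcM normRc_i mul1r !normRc_real.
Qed.

Lemma RcomplexZE (k : R) (z : R[i]) : k *: (z : Rcomplex R) = k%:C * z.
Proof. by case: z => a b; simpc. Qed.

Lemma cvg_Rcomplex (S : Type) (F : set_system S) (FF : Filter F)
    (f : S -> Rcomplex R) (l : Rcomplex R) :
  complex.Re (f s) @[s --> F] --> complex.Re l ->
  complex.Im (f s) @[s --> F] --> complex.Im l -> f @ F --> l.
Proof.
move=> /cvgrPdist_le cre /cvgrPdist_le cim; apply/cvgrPdist_le => e e0.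
have e2 := divr_gt0 e0 (ltr0n R 2).
near=> s; apply: le_trans (normRc_le _) _.
rewrite (splitr e) !raddfB; apply: lerD.
  by near: s; exact: cre.
by near: s; exact: cim.
Unshelve. all: by end_near.
Qed.

(** The scalars of [Rcomplex R] are real, so multiplication by a complex constant is not its
    scaling; continuity follows from multiplicativity of the norm. *)
Lemma cvgMRc (S : Type) (F : set_system S) (FF : Filter F)
    (c : R[i]) (f : S -> Rcomplex R) (l : Rcomplex R) :
  f @ F --> l -> (c * f s : Rcomplex R) @[s --> F] --> (c * l : Rcomplex R).
Proof.
move=> /cvgrPdist_le fl; apply/cvgrPdist_le => e e0.
(* The summand 1 keeps the divisor positive when [c] is 0. *)
have c1 : 0 < `|c : Rcomplex R| + 1 by rewrite ltr_wpDl.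
have /fl := divr_gt0 e0 c1; apply: filterS => s.
rewrite -mulrBr normRcM ler_pdivlMr// => fs.
apply: le_trans fs; rewrite mulrC; apply: ler_wpM2l => //.
by rewrite lerDl.
Qed.

End RcomplexNorm.

Section RcomplexSums.
Variables (R : realType) (T : choiceType).

(** Real and imaginary parts are dominated by [K] as well, so each is a Cauchy family of reals;
    completeness is used for the reals alone. *)
Lemma is_cvg_dominated_sum (K : T -> R) (x : T -> Rcomplex R) :
  bounded_sums K -> (forall i, `|x i| <= K i) ->
  cvg (partial_sum x @ totally).
Proof.
move=> Kbnd xK.
have real_cvg (y : T -> R) : (forall i, `|y i| <= `|x i|) ->
    cvg (partial_sum y @ totally).
  move=> yx; apply: cauchy_cvg; apply: cauchy_exP.
  apply: (dominated_cauchy_ex Kbnd) => i.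
  exact: le_trans (yx i) (xK i).
have /cvg_ex[a ca] := real_cvg (fun i => complex.Re (x i))
  (fun i => normRc_ge_Re _).
have /cvg_ex[b cb] := real_cvg (fun i => complex.Im (x i))
  (fun i => normRc_ge_Im _).
apply/cvg_ex; exists (a +i* b : Rcomplex R); apply: cvg_Rcomplex => /=.
  by under eq_cvg do rewrite partial_sumE raddf_sum -partial_sumE.
by under eq_cvg do rewrite partial_sumE raddf_sum -partial_sumE.
Qed.

Lemma sumM (c : R[i]) (x : T -> Rcomplex R) :
  cvg (partial_sum x @ totally) ->
  sum (fun i => c * x i : Rcomplex R) = c * sum x :> R[i].
Proof.
move=> cx; apply: (@cvg_sumE _ _ (Rcomplex R)).
have -> : partial_sum (fun i => c * x i : Rcomplex R) =
    fun J => c * partial_sum x J.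
  by apply/funext => J; rewrite !partial_sumE mulr_sumr.
exact: cvgMRc cx.
Qed.

End RcomplexSums.

(** * The phase [expi] and its difference quotient at 0 *)

Section Expi.
Variable R : realType.

Lemma expi0 : expi (0 : R) = 1.
Proof. by rewrite /expi cos0 sin0. Qed.

Lemma expiD (x y : R) : expi (x + y) = expi x * expi y.
Proof. by rewrite /expi cosD sinD; simpc; congr (_ +i* _); ring. Qed.

Lemma norm_expi (x : R) : `|expi x : Rcomplex R| = 1.
Proof. by rewrite normRcE/= cos2Dsin2 sqrtr1. Qed.

(** Mean value theorem on the segment between 0 and [x], for either sign of [x]. *)
Lemma lip1_of_derive (f df : R -> R) (x : R) :
  (forall y : R, is_derive y 1 f (df y)) -> (forall y, `|df y| <= 1) ->
  `|f x - f 0| <= `|x|.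
Proof.
move=> fdf df1.
have cf a b : {within `[a, b], continuous f}.
  apply: derivable_within_continuous => y _.
  exact: (@ex_derive _ _ _ _ _ _ _ (fdf y)).
have [x0|/ltW x0] := leP 0 x.
  have [c _ ->] := MVT_segment x0 (fun y _ => fdf y) (cf _ _).
  by rewrite subr0 normrM ler_piMl.
have [c _ E] := MVT_segment x0 (fun y _ => fdf y) (cf _ _).
by rewrite distrC E sub0r normrM normrN ler_piMl.
Qed.

(** The factor 2 comes from estimating the cosine and the sine separately, each with Lipschitz
    constant 1. *)
Lemma norm_expiB1 (x : R) : `|expi x - 1 : Rcomplex R| <= 2 * `|x|.
Proof.
apply: le_trans (normRc_le _) _; rewrite mulr2n mulrDl mul1r /= oppr0 addr0.
apply: lerD.
  rewrite -[X in _ - X](@cos0 R).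
  apply: (@lip1_of_derive _ (fun y => - sin y)) => y.
  by rewrite normrN sin_max.
rewrite -[X in `|X|]subr0 -[X in _ - X](@sin0 R).
by apply: (@lip1_of_derive _ cos) => y; exact: cos_max.
Qed.

Lemma cvg_expi_diffquot (th : R) :
  h^-1 *: (expi (h * th) - 1 : Rcomplex R) @[h --> 0^'] -->
  ('i * th%:C : Rcomplex R).
Proof.
have dq (f df : R -> R) : (forall y : R, is_derive y 1 f (df y)) ->
    h^-1 * (f (h * th) - f 0) @[h --> 0^'] --> df 0 * th.
  move=> fdf.
  have D : is_derive (0 : R) 1 (fun h => f (h * th)) (df 0 * th).
    have D1 : is_derive (0 : R) 1 (fun h => h * th) th.
      by apply: is_derive_eq; rewrite scaler0 add0r [_%:A]mulr1.

    apply: (@is_derive1_comp _ f (fun h => h * th)).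
    by rewrite mul0r; exact: fdf.
  (* The quotient takes the literal shape of the derivative at 0 in direction 1. *)
  have -> : (fun h => h^-1 * (f (h * th) - f 0)) = (fun h : R =>
      h^-1 *: (((fun h => f (h * th)) \o shift 0) (h *: (1 : R)) - f (0 * th))).
    by apply/funext => h; rewrite /= addr0 mul0r [_%:A]mulr1.
  rewrite -(@derive_val _ _ _ _ _ _ _ D).
  exact: (@ex_derive _ _ _ _ _ _ _ D).
apply: cvg_Rcomplex => /=.
  have := dq cos (fun y => - sin y) (@is_derive_cos R).
  by rewrite sin0 cos0 !(mul0r, mul1r, oppr0, addr0).
have := dq sin cos (@is_derive_sin R).
by rewrite sin0 cos0 !(mul0r, mul1r, add0r, oppr0).
Qed.

End Expi.

(** * Differentiation of a sum of phases term by term *)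

Section ExpiSums.
Variables (R : realType) (T : choiceType) (n : nat) (K : T -> R).
Variables (b : 'I_n -> T -> R[i]) (th : 'I_n -> T -> R).
Hypothesis Kbnd : bounded_sums K.
Hypothesis bK : forall i, \sum_d `|b d i : Rcomplex R| <= K i.
Hypothesis bthK : forall i, \sum_d `|th d i| * `|b d i : Rcomplex R| <= K i.

(** Here [h] is a displacement in space or time, [b] holds the amplitudes at the base point, and
    [th] the rates at which their phases grow. *)
Let u h i : Rcomplex R := \sum_d expi (h * th d i) * b d i.

Lemma expi_sum_cvg (h : R) : cvg (partial_sum (u h) @ totally).
Proof.
apply: (is_cvg_dominated_sum Kbnd) => i; apply: le_trans (bK i).
apply: le_trans (ler_norm_sum _ _ _) _; apply: ler_sum => d _.
by rewrite normRcM norm_expi mul1r.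
Qed.

Let u' i : Rcomplex R := \sum_d 'i * (th d i)%:C * b d i.

Lemma expi_sum_deriv_cvg : cvg (partial_sum u' @ totally).
Proof.
apply: (is_cvg_dominated_sum Kbnd) => i; apply: le_trans (bthK i).
apply: le_trans (ler_norm_sum _ _ _) _; apply: ler_sum => d _.
by rewrite !normRcM normRc_i mul1r normRc_real.
Qed.

(** The error [E] of the difference quotient against the termwise derivative tends to 0 for each
    index and is dominated uniformly in [h], so Tannery's theorem applies. *)
Lemma expi_sum_diffquot :
  h^-1 *: (sum (u h) - sum (u 0)) @[h --> 0^'] --> sum u'.
Proof.
pose E (h : R) i : Rcomplex R := h^-1 *: (u h i - u 0 i) - u' i.
have EE h i : E h i = \sum_d
    ((h^-1 *: (expi (h * th d i) - 1 : Rcomplex R) - 'i * (th d i)%:C) * b d i).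
  rewrite /E /u /u' -sumrB scaler_sumr -sumrB; apply: eq_bigr => d _.
  by rewrite mul0r expi0 !RcomplexZE; ring.
have cu h := cvg_partial_sumB (@expi_sum_cvg h) (@expi_sum_cvg 0).
have cq h := cvg_partial_sumZ (k := h^-1) (cvgP _ (cu h)).
have cE h := cvg_partial_sumB (cvgP _ (cq h)) expi_sum_deriv_cvg.
have sE h : sum (E h) = h^-1 *: (sum (u h) - sum (u 0)) - sum u'.
  by rewrite (cvg_sumE (cE h)) (cvg_sumE (cq h)) (cvg_sumE (cu h)).
apply/subr_cvg0; under eq_cvg do rewrite -sE.
(* In the factor 3, a 2 comes from [norm_expiB1] and a 1 from the term [u']. *)
apply: (@tannery _ _ (fun i => 3 * K i)).
- exact: bounded_sumsZ.
- move=> h i; rewrite EE.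
  apply: le_trans (ler_norm_sum _ _ _) _.
  apply: le_trans (ler_wpM2l _ (bthK i)); last by [].
  rewrite mulr_sumr; apply: ler_sum => d _.
  rewrite normRcM mulrA; apply: ler_wpM2r => //.
  apply: le_trans (ler_normB _ _) _.
  rewrite normRcM normRc_i mul1r normRc_real.
  suff : `|h^-1 *: (expi (h * th d i) - 1 : Rcomplex R)| <= 2 * `|th d i| by lra.
  rewrite normrZ normfV.
  (* The majorant must serve every [h]; at 0 the convention that the inverse of 0 is 0 makes the
     quotient vanish. *)
  have [->|h0] := eqVneq h 0; first by rewrite normr0 invr0 mul0r mulr_ge0.
  rewrite mulrC ler_pdivrMr ?normr_gt0//.
  by apply: le_trans (norm_expiB1 _) _; rewrite normrM; lra.
- by move=> h; exact: cvgP (cE h).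
- move=> i; under eq_cvg do rewrite EE.
  have : (\sum_d (h^-1 *: (expi (h * th d i) - 1 : Rcomplex R)
       - 'i * (th d i)%:C) * b d i : Rcomplex R) @[h --> 0^']
       --> \sum_(d < n) (0 : Rcomplex R).
    apply: cvg_big => [|d _]; first exact: add_continuous.
    under eq_cvg do rewrite mulrC.
    rewrite -(mulr0 (b d i)); apply: cvgMRc.
    by apply/subr_cvg0; exact: cvg_expi_diffquot.
  by rewrite big1.
Qed.

End ExpiSums.

(** * Vectors with three components *)

Section Vec3.
Variable R : realType.

Lemma forall_I3 (Q : 'I_3 -> Prop) : Q 0 -> Q 1 -> Q 2 -> forall i, Q i.
Proof.
move=> Q0 Q1 Q2 [[|[|[|//]]] i3].
- by rewrite (_ : Ordinal i3 = 0)//; exact/val_inj.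
- by rewrite (_ : Ordinal i3 = 1)//; exact/val_inj.
- by rewrite (_ : Ordinal i3 = 2)//; exact/val_inj.
Qed.

Lemma sum_I3 (V : nmodType) (f : 'I_3 -> V) : \sum_i f i = f 0 + f 1 + f 2.
Proof.
rewrite !big_ord_recr big_ord0 /= add0r.
by congr (f _ + f _ + f _); exact/val_inj.
Qed.

Lemma vec3_0 (U : Type) (x y z : U) : vec3 x y z 0 0 = x.
Proof. by rewrite mxE. Qed.

Lemma vec3_1 (U : Type) (x y z : U) : vec3 x y z 1 0 = y.
Proof. by rewrite mxE. Qed.

Lemma vec3_2 (U : Type) (x y z : U) : vec3 x y z 2 0 = z.
Proof. by rewrite mxE. Qed.

Definition vec3E := (vec3_0, vec3_1, vec3_2).

Lemma enorm_sqr (w : 'cV[R]_3) :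
  enorm w ^+ 2 = w 0 0 ^+ 2 + w 1 0 ^+ 2 + w 2 0 ^+ 2.
Proof. by rewrite sqr_sqrtr ?sum_I3// !addr_ge0 ?sqr_ge0. Qed.

Lemma enorm_gt0 (w : 'cV[R]_3) : w != 0 -> 0 < enorm w.
Proof.
move=> w0; rewrite sqrtr_gt0 lt_neqAle sumr_ge0 ?andbT => [|i _];
  last exact: sqr_ge0.
apply: contra w0 => /eqP/esym/eqP; rewrite psumr_eq0 => [/allP w0|i _];
  last exact: sqr_ge0.
apply/eqP/matrixP => i j; rewrite ord1 mxE.
by have := w0 i (mem_index_enum _); rewrite sqrf_eq0 => /eqP.
Qed.

End Vec3.

(** * Eigenvectors of the symbol of the curl, and unitarity of their matrix *)

Section EigenvectorTheory.
Variables (R : realType) (w : 'cV[R]_3).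
Hypothesis w0 : w != 0.

Let enorm_neq0 : enorm w != 0.
Proof. by rewrite gt_eqF// enorm_gt0. Qed.

Lemma v_0E k : v_ 0 w k 0 = (w k 0 / enorm w)%:C.
Proof. by rewrite /v_ eqxx !mxE -rmorphM mulrC. Qed.

(** With real and imaginary parts separated, the identities below become rational identities over
    the reals. *)
Lemma v_genericE d k : r_ w != 0 -> d != 0 ->
  v_ d w k 0 = ((nu_ w)^-1 * (s_ w / enorm w ^+ 2 * w k 0 - 1)) +i*
               (- ((nu_ w)^-1 * (mu_ d w / enorm w ^+ 2 * r_ w k 0))).
Proof.
move=> r0 /negPf d0; rewrite /v_ d0 r0 !mxE.
by simpc; congr (_ +i* _); ring.
Qed.

(** With [t] as the only irrational, [Num.sqrt 3] becomes [3 * t], and the relation [t ^+ 2 = 3^-1]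
    suffices for the diagonal case. *)
Let t : R := (Num.sqrt 3)^-1.

Let sqrt3_t : Num.sqrt 3 = 3 * t.
Proof.
have s0 : Num.sqrt 3 != 0 :> R by rewrite sqrtr_eq0 -ltNge.
by apply: (mulIf s0); rewrite -expr2 sqr_sqrtr// /t divfK.
Qed.

Let t_sqr : t ^+ 2 = 3^-1.
Proof. by rewrite exprVn sqr_sqrtr. Qed.

Lemma v2_diagE :
  v2_diag R = vec3 (t / 2 +i* 2^-1) (t / 2 -i* 2^-1)
    ((- t) +i* 0).
Proof.
have h2 : (2 : R[i])^-1 = (2^-1 : R)%:C by rewrite fmorphV rmorph_nat.
apply/matrixP => i j; rewrite ord1 mxE [X in _ * X]mxE [RHS]mxE {j}; move: i.
have e : t * (3 * t) = 1 by have := t_sqr; rewrite expr2; lra.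
apply: forall_I3; rewrite /tnth /= ?h2 -/t ?sqrt3_t;
  simpc; congr (_ +i* _); lra.
Qed.

Lemma r_eq0 : r_ w = 0 -> forall k, w k 0 = w 0 0.
Proof.
move=> /matrixP r0; have := r0 0 0; have := r0 1 0; rewrite /r_ !vec3E !mxE.
by move=> e1 e2; apply: forall_I3; lra.
Qed.

(** The conjugation for negative [w 0 0] and the one for the last eigenvector cancel when both
    occur, hence the exclusive or. *)
Lemma v_diagE d k : r_ w = 0 -> d != 0 ->
  v_ d w k 0 = if (0 <= w 0 0) (+) (d == 1) then conjc (v2_diag R k 0)
               else v2_diag R k 0.
Proof.
move=> r0 /negPf d0; rewrite /v_ d0 r0 eqxx /=.
by case: (0 <= w 0 0); case: (d == 1); rewrite /= ?mxE ?mxE ?conjcK.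
Qed.

Lemma enorm_diag : r_ w = 0 -> enorm w = 3 * t * `|w 0 0|.
Proof.
move=> r0; rewrite /enorm sum_I3 !(r_eq0 r0).
have -> : w 0 0 ^+ 2 + w 0 0 ^+ 2 + w 0 0 ^+ 2 = 3 * w 0 0 ^+ 2 by ring.
by rewrite sqrtrM// sqrtr_sqr sqrt3_t.
Qed.

(** In vector form, i w × v = mu v. For [d = 0] both sides vanish. Otherwise, if [r_ w] is nonzero,
    use w × (1,1,1) = r, w × r = s w - |w|² (1,1,1) and mu² = |w|². If [r_ w = 0], the sign of
    [w 0 0] fixes both |w| and the choice between [v2_diag] and its conjugate. *)
Lemma curl_eigenvector d :
  [/\ 'i * ((w 1 0)%:C * v_ d w 2 0 - (w 2 0)%:C * v_ d w 1 0)
        = (mu_ d w)%:C * v_ d w 0 0,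
      'i * ((w 2 0)%:C * v_ d w 0 0 - (w 0 0)%:C * v_ d w 2 0)
        = (mu_ d w)%:C * v_ d w 1 0 &
      'i * ((w 0 0)%:C * v_ d w 1 0 - (w 1 0)%:C * v_ d w 0 0)
        = (mu_ d w)%:C * v_ d w 2 0].
Proof.
have [->|d0] := eqVneq d 0.
  by rewrite !v_0E /mu_ /tnth /=; split; simpc; congr (_ +i* _); ring.
have [r0|r0] := eqVneq (r_ w) 0; last first.
  set m := mu_ d w.
  have mu2 : m ^+ 2 = enorm w ^+ 2.
    by rewrite /m; move: d d0 {m}; apply: forall_I3 => // _;
      rewrite /mu_ /tnth /= ?sqrrN.
  have mq : m * (m / enorm w ^+ 2) = 1.
    by rewrite mulrA -expr2 mu2 divff// sqrf_eq0.
  have q0 : enorm w ^+ 2 != 0 by rewrite sqrf_eq0.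
  (* This removes the square of [m]; what is left is at most linear in [m] and holds for both
     signs. *)
  have mqx y z : m * (y * (m / enorm w ^+ 2 * z)) = y * z.
    by rewrite mulrCA [m * (_ * z)]mulrA mq mul1r.
  rewrite !v_genericE// /r_ !vec3E; simpc; rewrite -/m !mqx.
  move: q0; rewrite enorm_sqr /s_ sum_I3.
  set N := (nu_ w)^-1; set a := w 0 0; set b := w 1 0; set c := w 2 0 => q0.
  by split; congr (_ +i* _); field.
(* Linear arithmetic treats monomials as atoms, so the relation for [t ^+ 2] is supplied already
   multiplied by [w 0 0]. *)
have ea : w 0 0 * t ^+ 2 = w 0 0 * 3^-1 by rewrite t_sqr.
rewrite !v_diagE// v2_diagE !vec3E /mu_ !(r_eq0 r0 1) !(r_eq0 r0 2) enorm_diag//.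
move: d d0 ea; set a := w 0 0; apply: forall_I3 => // _ ea; rewrite /tnth /=.
  have [a0|a0] := ger0P a; rewrite /=; simpc; split; congr (_ +i* _); lra.
have [a0|a0] := ger0P a; rewrite /=; simpc; split; congr (_ +i* _); lra.
Qed.

(** The two eigenvalues are opposite and enter through the imaginary part only; in the diagonal case
    it is the definition. *)
Lemma v_2_conj k : v_ 2 w k 0 = conjc (v_ 1 w k 0).
Proof.
have [r0|r0] := eqVneq (r_ w) 0.
  by rewrite !v_diagE//; case: (0 <= w 0 0); rewrite /= ?conjcK.
rewrite !v_genericE//= /mu_ /tnth /=; by rewrite opprK !mulNr mulrN.
Qed.

(** This is V V† = 1, the order of the factors that reconstructs a vector from its coefficients. *)
Lemma v_unitary (i j : 'I_3) :
  \sum_d v_ d w i 0 * conjc (v_ d w j 0) = (i == j)%:R.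
Proof.
(* Since the first eigenvector is real and the other two are conjugate, the sum is real and involves
   only the first two. *)
have sumE (f : 'I_3 -> 'I_3 -> R[i]) (x : 'I_3 -> R) :
    (forall k, f 0 k = (x k)%:C) -> (forall k, f 2 k = conjc (f 1 k)) ->
    \sum_d f d i * conjc (f d j) = (x i * x j + 2 *
      (complex.Re (f 1 i) * complex.Re (f 1 j)
       + complex.Im (f 1 i) * complex.Im (f 1 j)))%:C.
  move=> f0 f2; rewrite sum_I3 !f0 !f2; case: (f 1 i) (f 1 j) => [y z] [y' z'].
  by simpc; congr (_ +i* _) => /=; ring.
have -> : (i == j)%:R = ((i == j)%:R : R)%:C by rewrite rmorph_nat.
etransitivity; first exact: (sumE (fun d k => v_ d w k 0) _ v_0E v_2_conj).
congr (_%:C); clear sumE.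
have [r0|r0] := eqVneq (r_ w) 0.
  have a0 : w 0 0 != 0.
    by apply: contra enorm_neq0 => /eqP a0; rewrite enorm_diag// a0 normr0 mulr0.
  have e3 : t ^+ 2 = 3^-1 := t_sqr.
  have wq k l : w k 0 / enorm w * (w l 0 / enorm w) = 3^-1.
    rewrite (r_eq0 r0 k) (r_eq0 r0 l) mulf_div -!expr2 enorm_sqr.
    rewrite (r_eq0 r0 1) (r_eq0 r0 2).
    have -> : w 0 0 ^+ 2 + w 0 0 ^+ 2 + w 0 0 ^+ 2 = 3 * w 0 0 ^+ 2 by ring.
    by field.
  (* Conjugating both numbers flips both imaginary parts, so the sign of [w 0 0] drops out. *)
  have conjRI (c : bool) (z z' : R[i]) : let f z := if c then conjc z else z in
      complex.Re (f z) * complex.Re (f z') + complex.Im (f z) * complex.Im (f z')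
      = complex.Re z * complex.Re z' + complex.Im z * complex.Im z'.
    by case: c z z' => -[x y] [x' y'] //=; rewrite mulrNN.
  rewrite wq !v_diagE// conjRI v2_diagE.
  by move: i j; apply: forall_I3; apply: forall_I3; rewrite !vec3E /=; lra.
rewrite !v_genericE//= /mu_ /tnth /=.
have q0 : enorm w ^+ 2 != 0 by rewrite sqrf_eq0.
set rho := r_ w 0 0 ^+ 2 + r_ w 1 0 ^+ 2 + r_ w 2 0 ^+ 2.
have rho0 : rho != 0 by rewrite /rho -enorm_sqr sqrf_eq0 gt_eqF// enorm_gt0.
have nuE : (nu_ w)^-1 ^+ 2 = enorm w ^+ 2 / (2 * rho).
  by rewrite exprVn /nu_ !exprMn exprVn sqr_sqrtr// (enorm_sqr (r_ w)) invf_div.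
(* Only squares of [nu_ w] and [enorm w] survive, so no square root remains for [field]. *)
have -> (p p' y y' : R) : 2 * ((nu_ w)^-1 * p * ((nu_ w)^-1 * p') +
   - ((nu_ w)^-1 * (- enorm w / enorm w ^+ 2 * y)) *
   - ((nu_ w)^-1 * (- enorm w / enorm w ^+ 2 * y'))) =
   enorm w ^+ 2 / rho * (p * p' + y * y' / enorm w ^+ 2).
  transitivity (2 * (nu_ w)^-1 ^+ 2 *
      (p * p' + enorm w ^+ 2 * (enorm w ^+ 2)^-1 ^+ 2 * (y * y'))); first by ring.
  by rewrite nuE; field; rewrite rho0 enorm_neq0.
rewrite mulf_div -expr2 {nuE}.
move: q0 rho0; rewrite {}/rho /r_ enorm_sqr /s_ sum_I3 !vec3E => q0 rho0.
move: i j; apply: forall_I3; apply: forall_I3;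
  by rewrite !vec3E /=; field; rewrite q0 rho0.
Qed.

End EigenvectorTheory.

(** * The lower bound on wave vectors and the summability hypothesis *)

Section WaveVectors.
Variable R : realType.

Lemma le_enorm (w : 'cV[R]_3) i : `|w i 0| <= enorm w.
Proof.
rewrite -sqrtr_sqr; apply: ler_wsqrtr.
by rewrite (bigD1 i)//= lerDl sumr_ge0// => j _; exact: sqr_ge0.
Qed.

Lemma le_cnorm (z : 'cV[R[i]]_3) i : `|z i 0 : Rcomplex R| <= cnorm z.
Proof.
rewrite -(ger0_norm (normr_ge0 (z i 0 : Rcomplex R))) -sqrtr_sqr.
apply: ler_wsqrtr.
by rewrite (bigD1 i)//= lerDl sumr_ge0// => j _; exact: sqr_ge0.
Qed.

Lemma cnorm_ge0 (z : 'cV[R[i]]_3) : 0 <= cnorm z.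
Proof. exact: sqrtr_ge0. Qed.

(** As [P] is invertible, some column of [P] has a nonzero product with [w]. The column is a lattice
    point, so this product is a nonzero multiple of 2 pi and exceeds 1 in absolute value; it is also
    at most [C * enorm w]. *)
Lemma wave_vectors_lower_bound (P : 'M[R]_3) : P \in unitmx ->
  (* The sum of all entries of [P] in absolute value serves every column at once, and the extra 1 in
     [C] makes it positive. *)
  exists2 c : R, 0 < c & forall w, wave_vectors (lattice P) w -> c <= enorm w.
Proof.
move=> Pu; pose C := 1 + \sum_j \sum_i `|P i j|.
have C0 : 0 < C.
  by rewrite ltr_wpDr// sumr_ge0// => j _; rewrite sumr_ge0.
exists C^-1; first by rewrite invr_gt0.
move=> w [dw /= /eqP w0].
have : P^T *m w != 0.
  apply: contra w0 => /eqP Pw0.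
  by rewrite -(mulKmx (_ : P^T \in unitmx) w) ?unitmx_tr// Pw0 mulmx0.
have [/existsP[j Pj] _|/existsPn Pw] :=
  boolP [exists j, (P^T *m w) j 0 != 0]; last first.
  case/eqP; apply/matrixP => j k; rewrite ord1 [RHS]mxE.
  by have := Pw j; rewrite negbK => /eqP.
have [k dk] : exists k : int, dot (col j P) w = 2 * pi * k%:~R.
  apply: dw; exists (delta_mx j 0) => //.
  by rewrite map_delta_mx -colE.
have dE : (P^T *m w) j 0 = dot (col j P) w.
  by rewrite mxE; apply: eq_bigr => i _; rewrite !mxE.
have k0 : k != 0 by apply: contra Pj => /eqP k0; rewrite dE dk k0 mulr0.
have k1 : 1 <= `|k%:~R : R|.
  by rewrite -intr_norm -[1]/(1%:~R) ler_int -gtz0_ge1 normr_gt0.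
have dC' : 1 <= `|dot (col j P) w|.
  rewrite dk normrM ger0_norm ?mulr_ge0 ?pi_ge0//.
  have := pi_ge2 R; nra.
rewrite -(ler_pM2l C0) divff ?gt_eqF//; apply: le_trans dC' _.
apply: le_trans (ler_norm_sum _ _ _) _.
apply: (@le_trans _ _ (\sum_i `|P i j| * enorm w)).
  by apply: ler_sum => i _; rewrite normrM mxE ler_wpM2l ?le_enorm.
rewrite -mulr_suml ler_wpM2r ?sqrtr_ge0// /C [X in 1 + X](bigD1 j)//= addrCA.
by rewrite lerDl addr_ge0// sumr_ge0// => i _; rewrite sumr_ge0.
Qed.

(** The extended sum is a supremum of finite sums, so its finite value bounds them all; [patch]
    extends the family by 0 to the whole type. *)
Lemma bounded_sums_esum (T : choiceType) (D : set T) (g : T -> R) :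
  (forall i, 0 <= g i) -> (\esum_(i in D) (g i)%:E < +oo)%E ->
  bounded_sums (patch (fun=> 0) D g).
Proof.
move=> g0; rewrite esum_mkcond => s_lty.
have s_ge0 : (0 <= \esum_(i in [set: T]) (if i \in D then (g i)%:E else 0))%E.
  by apply: esum_ge0 => i _; case: ifP; rewrite ?lee_fin.
set s := esum _ _ in s_lty s_ge0.
exists (fine s) => J.
rewrite -lee_fin fineK ?ge0_fin_numE// -sumEFin.
apply: esum_ge; exists [set` J]; first by split.
rewrite fsbig_finite//= set_fsetK.
by apply: lee_sum => i _; rewrite /patch; case: ifP.
Qed.

End WaveVectors.

Lemma diffquot_dC (R : realType) (U : normedModType R) (f : U -> Rcomplex R)
    (x v : U) (l : Rcomplex R) :
  h^-1 *: (f (h *: v + x) - f x) @[h --> 0^'] --> l ->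
  derivable f x v /\ dC f x v = l.
Proof.
move=> fl; split; first by apply/cvg_ex; exists l.
by apply: (@cvg_lim (Rcomplex R)); first exact: norm_hausdorff.
Qed.

(** * The series of modes, its derivatives and Maxwell's equations *)

Section Solution.
Variables (R : realType) (s : R) (D : set 'cV[R]_3).
Variables (a : 'cV[R]_3 -> 'cV[R[i]]_3).
Hypothesis D0 : forall w, D w -> w != 0.

(** The rows of a unitary matrix have norm 1. *)
Lemma norm_v_le1 d w i : w != 0 -> `|v_ d w i 0 : Rcomplex R| <= 1.
Proof.
move=> w0; have := v_unitary w0 i i; rewrite eqxx => E.
have {E} : \sum_d `|v_ d w i 0 : Rcomplex R| ^+ 2 = 1.
  apply: (@complexI R); rewrite rmorph_sum /= -[RHS]E; apply: eq_bigr => e _.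
  case: (v_ e w i 0) => x y; rewrite normRcE sqr_sqrtr ?addr_ge0 ?sqr_ge0//=.
  by simpc; congr (_ +i* _); ring.
rewrite (bigD1 d)//= => E; rewrite -(@expr_le1 _ 2)// -E lerDl.
by rewrite sumr_ge0.
Qed.

Lemma norm_alpha_le d w : w != 0 ->
  `|alpha_ a d w : Rcomplex R| <= 3 * cnorm (a w).
Proof.
move=> w0; rewrite /alpha_ mxE; apply: le_trans (ler_norm_sum _ _ _) _.
apply: (@le_trans _ _ (\sum_(i < 3) cnorm (a w))); last first.
  by rewrite sumr_const card_ord mulr_natl.
apply: ler_sum => i _; rewrite normRcM !mxE normRc_conj.
rewrite -[leRHS]mul1r; apply: ler_pM => //; first exact: norm_v_le1.
exact: le_cnorm.
Qed.

(** V V† a = a, read in one component. *)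
Lemma sum_alpha_v w k : w != 0 -> \sum_d alpha_ a d w * v_ d w k 0 = a w k 0.
Proof.
move=> w0.
transitivity (\sum_j a w j 0 * \sum_d v_ d w k 0 * conjc (v_ d w j 0)).
  under [RHS]eq_bigr do rewrite mulr_sumr.
  rewrite exchange_big /=; apply: eq_bigr => d _.
  rewrite /alpha_ mxE mulr_suml; apply: eq_bigr => j _.
  by rewrite !mxE; ring.
under eq_bigr do rewrite v_unitary//.
rewrite (bigD1 k)//= eqxx mulr1 big1 ?addr0// => j /negPf jk.
by rewrite eq_sym jk mulr0.
Qed.

(** Here [s] stands for the square root of mu times epsilon. *)
Definition mode x t w := \sum_(d < 3)
  (expi (- (t * mu_ d w / s)) * alpha_ a d w * expi (dot x w)) *: v_ d w.

(** Extension by 0 outside [D] lets the sums run over the whole type, in the form required of the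
    amplitudes [b] above. *)
Definition mode_amp x t k d w : R[i] :=
  if w \in D then expi (- (t * mu_ d w / s)) * alpha_ a d w * expi (dot x w)
                    * v_ d w k 0 else 0.

Lemma coord_on_mode x t k w :
  coord_on D (mode x t) k w = \sum_d mode_amp x t k d w.
Proof.
rewrite /coord_on /patch /mode_amp; case: ifP => [_|_]; last by rewrite big1.
by rewrite summxE; apply: eq_bigr => d _; rewrite mxE.
Qed.

Lemma norm_amp x t k d w :
  `|mode_amp x t k d w : Rcomplex R| <=
  3 * patch (fun=> 0) D (fun w => cnorm (a w)) w.
Proof.
rewrite /mode_amp /patch; case: ifPn => [/set_mem/D0 w0|_];
  last by rewrite normr0 mulr0.
rewrite !normRcM !norm_expi mul1r mulr1 -[leRHS]mulr1.
by apply: ler_pM => //; [exact: norm_alpha_le|exact: norm_v_le1].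
Qed.

Lemma mu_norm_le d (w : 'cV[R]_3) : `|mu_ d w| <= enorm w.
Proof.
have e0 : 0 <= enorm w by exact: sqrtr_ge0.
by move: d; apply: forall_I3; rewrite /mu_ /tnth /= ?normr0 ?normrN ?ger0_norm.
Qed.

Variables (f0 : 'cV[R[i]]_3) (c : R).
Hypothesis s0 : 0 < s.
Hypothesis c0 : 0 < c.
Hypothesis Dc : forall w, D w -> c <= enorm w.
Hypothesis Dbnd :
  bounded_sums (patch (fun=> 0) D (fun w => enorm w * cnorm (a w))).

(** One majorant for the terms and their derivatives: 9 counts three eigenvectors with amplitudes at
    most 3 |a|, [c^-1] trades |a| for |w| |a|, and [1 + s^-1] covers the rates of phase in space and
    time. *)
Let K w :=
  9 * (c^-1 + 1 + s^-1) * patch (fun=> 0) D (fun w => enorm w * cnorm (a w)) w.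

Let Kbnd : bounded_sums K.
Proof.
apply: bounded_sumsZ => //.
by rewrite mulr_ge0// !addr_ge0// invr_ge0 ltW.
Qed.

Let mode_ampK x t k w : \sum_d `|mode_amp x t k d w : Rcomplex R| <= K w.
Proof.
apply: (le_trans (ler_sum _ (fun d _ => norm_amp x t k d w))).
rewrite sumr_const card_ord /K /patch -[_ *+ 3]mulr_natl.
case: ifPn => [/set_mem/Dc cw|]; last by rewrite !mulr0.
have a0 := cnorm_ge0 (a w).
have w1 : 1 <= c^-1 * enorm w by rewrite mulrC ler_pdivlMr// mul1r.
have e0 : 0 <= enorm w by exact: sqrtr_ge0.
have s1 : 0 <= s^-1 * enorm w by rewrite mulr_ge0// invr_ge0 ltW.
rewrite mulrA -natrM -!mulrA ler_pM2l// mulrA ler_peMl//.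
by rewrite !mulrDl mul1r; lra.
Qed.

(** The bound on [th] admits both [w j 0], for space, and [- (mu_ d w / s)], for time. *)
Let mode_ampthK x t k (th : 'I_3 -> 'cV[R]_3 -> R) w :
  (forall d, `|th d w| <= (1 + s^-1) * enorm w) ->
  \sum_d `|th d w| * `|mode_amp x t k d w : Rcomplex R| <= K w.
Proof.
move=> thw; have e0 : 0 <= enorm w by exact: sqrtr_ge0.
apply: (@le_trans _ _ (\sum_(d < 3) ((1 + s^-1) * enorm w *
    (3 * patch (fun=> 0) D (fun w => cnorm (a w)) w)))).
  by apply: ler_sum => d _; apply: ler_pM => //; exact: norm_amp.
rewrite sumr_const card_ord /K /patch -[_ *+ 3]mulr_natl.
case: ifPn => [_|_]; last by rewrite !mulr0.
have -> : 3 * ((1 + s^-1) * enorm w * (3 * cnorm (a w))) =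
    9 * (1 + s^-1) * (enorm w * cnorm (a w)) by ring.
apply: ler_wpM2r; first by rewrite mulr_ge0// cnorm_ge0.
by rewrite ler_pM2l// lerD2r lerDr invr_ge0 ltW.
Qed.

Lemma vsum_cvg_mode x t : vsum_cvg D (mode x t).
Proof.
move=> k; apply: (is_cvg_dominated_sum Kbnd) => w; rewrite coord_on_mode.
exact: le_trans (ler_norm_sum _ _ _) (mode_ampK x t k w).
Qed.

Definition mode_series x t := f0 + vsum D (mode x t).

Let mode_seriesE x t k : mode_series x t k 0 = f0 k 0 + sum (coord_on D (mode x t) k).
Proof. by rewrite !mxE. Qed.

Definition mode_deriv th x t k w : Rcomplex R :=
  \sum_d 'i * (th d w)%:C * mode_amp x t k d w.

(* Along a line in space or in time, [mode_amp] is only multiplied by a phase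
   that is linear in the parameter. *)
Let mode_series_diffquot (th : 'I_3 -> 'cV[R]_3 -> R) x t k
    (y : R -> 'cV[R]_3) (r : R -> R) :
  (forall d w, `|th d w| <= (1 + s^-1) * enorm w) ->
  (forall h d w, mode_amp (y h) (r h) k d w =
    expi (h * th d w) * mode_amp x t k d w) ->
  y 0 = x -> r 0 = t ->
  h^-1 *: (mode_series (y h) (r h) k 0 - mode_series x t k 0 : Rcomplex R) @[h --> 0^'] -->
    sum (mode_deriv th x t k).
Proof.
move=> thw ampE y0 r0.
have := @expi_sum_diffquot _ _ _ K (mode_amp x t k) th Kbnd (mode_ampK x t k)
  (fun w => mode_ampthK x t k (thw^~ w)).
(* The constant [f0] cancels in the difference. *)
suff E h : mode_series (y h) (r h) k 0 - mode_series x t k 0 =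
  sum (fun i : 'cV[R]_3 =>
    \sum_d expi (h * th d i) * mode_amp x t k d i : Rcomplex R) -
  sum (fun i : 'cV[R]_3 =>
    \sum_d expi (0 * th d i) * mode_amp x t k d i : Rcomplex R)
  :> Rcomplex R.
  by under eq_cvg do rewrite -E.
have sE h' : coord_on D (mode (y h') (r h')) k =
    (fun w => \sum_d expi (h' * th d w) * mode_amp x t k d w).
  by apply/funext => w; rewrite coord_on_mode; apply: eq_bigr => d _.
have := sE 0; rewrite y0 r0 => sE0.
by rewrite !mode_seriesE opprD addrACA subrr add0r sE sE0.
Qed.

Lemma dt_mode_series x t k :
  derivable ((fun s => mode_series x s k 0) : R -> Rcomplex R) t 1 /\
  dt mode_series x t k 0 = sum (mode_deriv (fun d w => - (mu_ d w / s)) x t k).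
Proof.
rewrite mxE; apply: diffquot_dC.
have -> : (fun h : R => h^-1 *: ((mode_series x (h *: (1 : R) + t) k 0 : Rcomplex R)
      - mode_series x t k 0)) =
    (fun h : R => h^-1 *: (mode_series x (h + t) k 0 - mode_series x t k 0 : Rcomplex R)).
  by apply/funext => h; rewrite [_%:A]mulr1.
apply: (@mode_series_diffquot _ x t k (fun=> x) (fun h => h + t)) => //.
- move=> d w; rewrite normrN normrM [in `|s^-1|]gtr0_norm ?invr_gt0// mulrC.
  have := mu_norm_le d w; have e0 : 0 <= enorm w by exact: sqrtr_ge0.
  have s1 : 0 <= s^-1 by rewrite invr_ge0 ltW.
  move=> me; rewrite mulrDl mul1r; apply: le_trans (ler_wpM2l s1 me) _.
  by rewrite lerDr.
- move=> h d w; rewrite /mode_amp; case: ifP; rewrite ?mulr0// => _.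
  rewrite !mulrA -expiD; congr (expi _ * _ * _ * _); ring.
- exact: add0r.
Qed.

Lemma dx_mode_series x t k j :
  derivable ((fun y => mode_series y t k 0) : 'cV[R]_3 -> Rcomplex R) x
    (basis3 R j) /\
  dC (fun y => mode_series y t k 0) x (basis3 R j) =
    sum (mode_deriv (fun d w => w j 0) x t k).
Proof.
apply: diffquot_dC.
apply: (@mode_series_diffquot _ x t k (fun h => h *: basis3 R j + x) (fun=> t)) => //.
- move=> d w; apply: le_trans (le_enorm w j) _.
  by rewrite mulrDl mul1r lerDl mulr_ge0 ?sqrtr_ge0// invr_ge0 ltW.
- move=> h d w; rewrite /mode_amp; case: ifP; rewrite ?mulr0// => _.
  have -> : dot (h *: basis3 R j + x) w = h * w j 0 + dot x w.
    rewrite /dot (eq_bigr (fun i =>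
        h * (basis3 R j i 0 * w i 0) + x i 0 * w i 0)).
      rewrite big_split/= -mulr_sumr; congr (_ * _ + _).
      rewrite (bigD1 j)//= !mxE !eqxx mul1r big1 ?addr0// => i /negPf ij.
      by rewrite mxE ij mul0r.
    by move=> i _; rewrite !mxE mulrDl mulrA.
  by rewrite expiD; ring.
- by rewrite scale0r add0r.
Qed.

(** The time derivative multiplies a mode by -i mu / s and the curl acts as i w ×, so the
    eigenvector identity matches the two sums term by term. Generic indices let the three cyclic
    components share the argument. *)
Lemma maxwell_component x t (j k l : 'I_3) :
  (forall (w : 'cV[R]_3) d, w != 0 ->
    'i * ((w j 0)%:C * v_ d w k 0 - (w k 0)%:C * v_ d w j 0)
    = (mu_ d w)%:C * v_ d w l 0) ->
  dt mode_series x t l 0 = - ('i / s%:C) *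
    (dC (fun y => mode_series y t k 0) x (basis3 R j)
     - dC (fun y => mode_series y t j 0) x (basis3 R k)).
Proof.
move=> eig; rewrite (dt_mode_series x t l).2.
rewrite (dx_mode_series x t k j).2 (dx_mode_series x t j k).2.
have cdF i m : cvg (partial_sum (mode_deriv (fun d w => w i 0) x t m) @ totally).
  apply: (expi_sum_deriv_cvg Kbnd) => w.
  apply: (@mode_ampthK x t m (fun=> fun w => w i 0)) => d.
  apply: le_trans (le_enorm w i) _.
  by rewrite mulrDl mul1r lerDl mulr_ge0 ?sqrtr_ge0// invr_ge0 ltW.
have cB := cvg_partial_sumB (cdF j k) (cdF k j).
rewrite -[X in _ * X](cvg_sumE cB) -(sumM _ (cvgP _ cB)).
apply: (f_equal (@sum _ _ (Rcomplex R))); apply/funext => w.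
rewrite /mode_deriv -sumrB mulr_sumr; apply: eq_bigr => d _.
rewrite /mode_amp; case: ifPn => [/set_mem/D0 w0|_];
  last by rewrite !mulr0 subr0 mulr0.
have := eig w d w0.
(* The scalar amplitude [g] is common to all components of the mode. *)
set g := expi _ * _ * _ => E.
have -> : (- (mu_ d w / s))%:C = - ((mu_ d w)%:C / s%:C).
  by rewrite rmorphN rmorphM fmorphV.
have -> : 'i * - ((mu_ d w)%:C / s%:C) * (g * v_ d w l 0) =
  - ('i / s%:C) * g * ((mu_ d w)%:C * v_ d w l 0) by ring.
by rewrite -E; ring.
Qed.

Lemma maxwell_solution x t :
  dt mode_series x t = - ('i / s%:C) *: curl (fun y => mode_series y t) x.
Proof.
apply/matrixP => l i; rewrite ord1 {i} [RHS]mxE /curl; move: l.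
apply: forall_I3; rewrite vec3E; apply: maxwell_component => w d w0.
- by have [] := curl_eigenvector w0 d.
- by have [] := curl_eigenvector w0 d.
- by have [] := curl_eigenvector w0 d.
Qed.

Lemma mode_series_at_0 x : mode_series x 0 = f0 + vsum D (fun w => expi (dot x w) *: a w).
Proof.
rewrite /mode_series; congr (_ + _); apply/matrixP => k j; rewrite !mxE.
apply: (f_equal (@sum _ _ (Rcomplex R))); apply/funext => w.
rewrite /coord_on /patch.
case: ifP => // /set_mem/D0 w0; rewrite summxE [RHS]mxE -sum_alpha_v// mulr_sumr.
apply: eq_bigr => d _; rewrite mxE !mul0r oppr0 expi0; ring.
Qed.

End Solution.

Theorem theorem2p7 (R : realType) (eps mu : R) (eps_gt0 : 0 < eps)
  (mu_gt0 : 0 < mu) (P : 'M[R]_3) (P_unit : P \in unitmx)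
  (F0 : 'cV[R]_3 -> 'cV[R[i]]_3) (F0_periodic : periodic_wrt (lattice P) F0)
  (f0 : 'cV[R[i]]_3) (a : 'cV[R]_3 -> 'cV[R[i]]_3)
  (F0_fourier : forall x,
     vsum_cvg (wave_vectors (lattice P)) (fun w => expi (dot x w) *: a w) /\
     F0 x = f0 + vsum (wave_vectors (lattice P))
                   (fun w => expi (dot x w) *: a w))
  (a_summable :
     (\esum_(w in wave_vectors (lattice P)) (enorm w * cnorm (a w))%:E
      < +oo)%E) :
  let term x t w := \sum_(d < 3)
    (expi (- (t * mu_ d w / Num.sqrt (mu * eps))) * alpha_ a d w
     * expi (dot x w)) *: v_ d w in
  let F x t := f0 + vsum (wave_vectors (lattice P)) (term x t) in
  (forall x t, vsum_cvg (wave_vectors (lattice P)) (term x t)) /\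
  solves_cauchy eps mu F0 F.
Proof.
move=> term F.
have s0 : 0 < Num.sqrt (mu * eps) by rewrite sqrtr_gt0 mulr_gt0.
(* Invertibility of [P] enters here; the bound [c] makes the amplitudes themselves summable. *)
have [c c0 Dc] := wave_vectors_lower_bound P_unit.
have D0 w : wave_vectors (lattice P) w -> w != 0 by case=> _ /= /eqP.
have Dbnd : bounded_sums (patch (fun=> 0) (wave_vectors (lattice P))
    (fun w => enorm w * cnorm (a w))).
  apply: bounded_sums_esum => // w.
  by rewrite mulr_ge0 ?cnorm_ge0 ?sqrtr_ge0.
split; first exact: (vsum_cvg_mode D0 s0 c0 Dc Dbnd).
split.
- move=> x t k; split; first exact: (dt_mode_series D0 f0 s0 c0 Dc Dbnd x t k).1.
  by move=> j; exact: (dx_mode_series D0 f0 s0 c0 Dc Dbnd x t k j).1.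
- exact: (maxwell_solution D0 f0 s0 c0 Dc Dbnd).
- move=> x; rewrite (F0_fourier x).2; exact: (mode_series_at_0 _ a D0).
Qed.
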